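(* Let $l\ge1$ be an integer, $h$ a cusp form of weight two for $\Gamma_0(l)$, $i\in\mathbb{Z}/l\mathbb{Z}$, and $\chi:(\mathbb{Z}/l\mathbb{Z})^*\to\mathbb{C}^*$ a character. For every integer $k\ge 3$ the series defining $E_{k,i;h}(\tau)$ and $\hat E_{k,\chi;h}(\tau)$ converge absolutely to holomorphic functions on the upper half plane.
   Context: $\Gamma_0(l)$ is the group of matrices $\begin{pmatrix}a&b\\c&d\end{pmatrix}\in SL_2(\mathbb{Z})$ with $c\in l\mathbb{Z}$. For a cusp form $h$ of weight two for $\Gamma_0(l)$ put $H(\tau)=\int_{i\infty}^{\tau}h(s)\,ds$. For $c\in l\mathbb{Z}$, $c\ne0$, $d\in\mathbb{Z}$, $\gcd(d,l)=1$, $H(-\frac dc)=\int_{i\infty}^{-d/c}h(s)\,ds$ (integral between cusps, convergent because $h$ is a cusp form); convention: $H(-\frac d0)=0$. Write $i_0=\sqrt{-1}$. The series are $$\hat E_{k,\chi;h}(\tau)=\sum_{c\in l\mathbb{Z}}\ \sum_{d\in\mathbb{Z},\,\gcd(c,d)=1}(c\tau+d)^{-k}\chi(d)\,e^{2\pi i_0\,\mathrm{Re}\,H(-\frac dc)}$$ (equivalently a sum over $\Gamma_\infty\backslash\Gamma_0(l)$, where $\Gamma_\infty$ is the infinite cyclic group generated by $\tau\mapsto\tau+1$), and $$E_{k,i;h}(\tau)=\sum_{c\in l\mathbb{Z}}\ \sum_{d\in\mathbb{Z},\,\gcd(l,d)=1}(c\tau+d)^{-k}e^{-2\pi i_0\frac{di}{l}}\,e^{2\pi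 i_0\,\mathrm{Re}\,H(-\frac dc)},$$ where $(c,d)=(0,0)$ is excluded (automatic for $l\ge2$). *)

(* Defs.v *)
(* Stdlib reals with Coquelicot *)
From Stdlib Require Import Reals ZArith List.
From Coquelicot Require Import Coquelicot.

Open Scope R_scope.
Open Scope C_scope.

Definition ZtoC (n : Z) : C := RtoC (IZR n).

Definition Cexp (z : C) : C := RtoC (exp (Re z)) * (cos (Im z), sin (Im z)).

Definition upper_half_plane (tau : C) : Prop := (0 < Im tau)%R.

(* [C_AbsRing] makes this complex, not real, differentiability. *)
Definition holomorphic_on_uhp (f : C -> C) : Prop :=
  forall tau : C, upper_half_plane tau ->
    @ex_derive C_AbsRing C_NormedModule f tau.

(** * Cusp forms of weight two *)

Definition SL2Z (a b c d : Z) : Prop := (a * d - b * c = 1)%Z.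

Definition Gamma0 (l a b c d : Z) : Prop := SL2Z a b c d /\ (l | c)%Z.

Definition moebius (a b c d : Z) (tau : C) : C :=
  (ZtoC a * tau + ZtoC b) / (ZtoC c * tau + ZtoC d).

Definition slash2 (a b c d : Z) (h : C -> C) (tau : C) : C :=
  / (ZtoC c * tau + ZtoC d) ^ 2 * h (moebius a b c d tau).

Definition zero_at_i_infinity (f : C -> C) : Prop :=
  forall eps : R, (0 < eps)%R ->
    exists A : R, forall tau : C,
      upper_half_plane tau -> (A < Im tau)%R -> (Cmod (f tau) < eps)%R.

(* Every cusp is the image of i*oo under some element of SL_2(Z), so the last
   field says that h vanishes at all the cusps.  Only the values of h on the
   upper half plane matter. *)
Record weight2_cusp_form (l : Z) (h : C -> C) : Prop := {
  cusp_form_holomorphic : holomorphic_on_uhp h;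
  cusp_form_modular : forall a b c d : Z, Gamma0 l a b c d ->
    forall tau : C, upper_half_plane tau -> slash2 a b c d h tau = h tau;
  cusp_form_vanishing : forall a b c d : Z, SL2Z a b c d ->
    zero_at_i_infinity (slash2 a b c d h)
}.

(** * The integral H *)

(* The integral of h from i*oo to z along the vertical line s = z + i t, with t
   running from +oo down to 0.  The integral is improper at both ends, so z may
   be a point of the upper half plane or a rational cusp. *)
Definition H_integral (h : C -> C) (z : C) : C :=
  @RInt_gen C_R_CompleteNormedModule
    (fun t : R => h (z + Ci * RtoC t) * Ci)
    (Rbar_locally p_infty) (at_right 0).

Definition H_cusp (h : C -> C) (c d : Z) : C :=
  if Z.eq_dec c 0 then RtoC 0 else H_integral h (- (ZtoC d / ZtoC c)).

(** * Characters of (Z/lZ)^* *)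

(* A map (Z/lZ)^* -> C^* is given as a function on the integers; its values at
   integers not coprime to l are irrelevant.  For l = 1 every integer is
   coprime to l.  chi 1 = 1 follows from the last two fields. *)
Record unit_character (l : Z) (chi : Z -> C) : Prop := {
  unit_character_mod : forall d e : Z,
    Z.gcd d l = 1%Z -> (l | d - e)%Z -> chi d = chi e;
  unit_character_mul : forall d e : Z,
    Z.gcd d l = 1%Z -> Z.gcd e l = 1%Z -> chi (d * e)%Z = chi d * chi e;
  unit_character_neq0 : forall d : Z, Z.gcd d l = 1%Z -> chi d <> RtoC 0
}.

(** * Sums over subsets of a type *)

Definition sum_list {T : Type} (f : T -> C) (s : list T) : C :=
  fold_right (fun x acc => f x + acc) (RtoC 0) s.

(* The finite subsets of D, given as duplicate-free lists, directed by
   inclusion. *)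
Definition finite_subsets {T : Type} (D : T -> Prop) : (list T -> Prop) -> Prop :=
  fun P => exists s0 : list T, List.Forall D s0 /\
    forall s : list T, NoDup s -> List.Forall D s -> incl s0 s -> P s.

Definition has_sum {T : Type} (D : T -> Prop) (f : T -> C) (v : C) : Prop :=
  filterlim (sum_list f) (finite_subsets D) (locally v).

Definition abs_summable {T : Type} (D : T -> Prop) (f : T -> C) : Prop :=
  exists M : R, forall s : list T, NoDup s -> List.Forall D s ->
    (fold_right (fun x acc => Cmod (f x) + acc)%R 0%R s <= M)%R.

Definition converges_absolutely_to_holomorphic {T : Type}
    (D : T -> Prop) (f : C -> T -> C) : Prop :=
  (forall tau : C, upper_half_plane tau -> abs_summable D (f tau)) /\
  exists F : C -> C,
    (forall tau : C, upper_half_plane tau -> has_sum D (f tau) (F tau)) /\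
    holomorphic_on_uhp F.

(** * The Eisenstein series *)

(* The index sets consist of pairs (c, d). *)

Definition E_index (l : Z) (p : Z * Z) : Prop :=
  let (c, d) := p in
  (l | c)%Z /\ Z.gcd l d = 1%Z /\ ~ (c = 0%Z /\ d = 0%Z).

(* i is an integer representing a class modulo l. *)
Definition E_term (l : Z) (k : nat) (i : Z) (h : C -> C)
    (tau : C) (p : Z * Z) : C :=
  let (c, d) := p in
  / (ZtoC c * tau + ZtoC d) ^ k
  * Cexp (- (2 * PI * Ci * (ZtoC (d * i) / ZtoC l)))
  * Cexp (2 * PI * Ci * Re (H_cusp h c d)).

Definition Ehat_index (l : Z) (p : Z * Z) : Prop :=
  let (c, d) := p in (l | c)%Z /\ Z.gcd c d = 1%Z.

Definition Ehat_term (k : nat) (chi : Z -> C) (h : C -> C)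
    (tau : C) (p : Z * Z) : C :=
  let (c, d) := p in
  / (ZtoC c * tau + ZtoC d) ^ k
  * chi d
  * Cexp (2 * PI * Ci * Re (H_cusp h c d)).

(* Main.v *)
Require Import Defs.
From Stdlib Require Import Reals ZArith List.
From Coquelicot Require Import Coquelicot.
From Stdlib Require Import Lra Lia Permutation IndefiniteDescription.

(** Both series have the shape [sum a(c,d) / (c * tau + d) ^ k] over nonzero
    integer pairs, with bounded coefficients [a(c,d)]: the factors
    [e^(2 pi i Re H)] and [e^(-2 pi i d i / l)] have modulus one, because their
    exponents are purely imaginary, and [chi] takes finitely many values on the
    integers prime to [l], because it is periodic modulo [l] there.  Everything therefore follows from
    [eisenstein_bounded_coefficients], and the modular form [h] enters only
    through a real phase.

    Absolute convergence is the classical comparison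
    [max(|c|,|d|) <= K(tau) |c * tau + d|] ([sup_norm_le_lattice_point]),
    together with [sum max(|c|,|d|)^-3 < oo] ([abs_summable_inv_cube]): the
    square shell of sup norm [n] has [O(n)] points, so it contributes
    [O(n^-2)].

    Holomorphy is proved directly from the definition of the derivative, without
    locally uniform convergence.  Put [u = c * tau0 + d] and
    [z = c * (tau - tau0) / u].  Then [c * tau + d = u * (1 + z)], and
    [|z| <= |tau - tau0| / Im tau0] whatever [(c,d)] is.  The expansion
    [(1 + z)^-k = 1 - k z + O(z^2)] ([inv_pow_taylor]) bounds the second-order
    remainder of the term [(c,d)] by a constant times
    [|tau - tau0|^2 |u|^-k] ([lattice_term_taylor]).  These bounds are summable
    at the single point [tau0], so the sum is differentiable there with the
    termwise derivative ([has_sum_is_derive]). *)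

Local Open Scope C_scope.

(** * Unconditional sums of complex numbers *)

Definition norm_sum {T : Type} (f : T -> C) (s : list T) : R :=
  fold_right (fun x acc => Cmod (f x) + acc)%R 0%R s.

Lemma norm_sum_ge0 {T : Type} (f : T -> C) (s : list T) : (0 <= norm_sum f s)%R.
Proof.
  induction s as [|x s IH]; simpl; [lra|].
  pose proof (Cmod_ge_0 (f x)); lra.
Qed.

Lemma norm_sum_app {T : Type} (f : T -> C) (s t : list T) :
  norm_sum f (s ++ t) = (norm_sum f s + norm_sum f t)%R.
Proof. induction s as [|x s IH]; simpl; [lra|]. rewrite IH; lra. Qed.

Lemma norm_sum_Permutation {T : Type} (f : T -> C) (s t : list T) :
  Permutation s t -> norm_sum f s = norm_sum f t.
Proof. intros H; induction H; simpl; lra. Qed.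

Lemma norm_sum_le {T : Type} (D : T -> Prop) (f g : T -> C) (B : R) (s : list T) :
  List.Forall D s ->
  (forall x, D x -> (Cmod (f x) <= B * Cmod (g x))%R) ->
  (norm_sum f s <= B * norm_sum g s)%R.
Proof.
  intros Hs Hfg; induction Hs as [|x s Hx Hs IH]; simpl; [lra|].
  specialize (Hfg x Hx); lra.
Qed.

Lemma sum_list_app {T : Type} (f : T -> C) (s t : list T) :
  sum_list f (s ++ t) = sum_list f s + sum_list f t.
Proof. induction s as [|x s IH]; simpl; [ring|]. rewrite IH; ring. Qed.

Lemma sum_list_Permutation {T : Type} (f : T -> C) (s t : list T) :
  Permutation s t -> sum_list f s = sum_list f t.
Proof.
  intros H; induction H; simpl; [reflexivity | | ring | congruence].
  now rewrite IHPermutation.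
Qed.

Lemma Cmod_sum_list_le {T : Type} (f : T -> C) (s : list T) :
  (Cmod (sum_list f s) <= norm_sum f s)%R.
Proof.
  induction s as [|x s IH]; simpl; [rewrite Cmod_0; lra|].
  eapply Rle_trans; [apply Cmod_triangle|]; lra.
Qed.

Lemma norm_sum_In {T : Type} (f : T -> C) (s : list T) (x : T) :
  In x s -> (Cmod (f x) <= norm_sum f s)%R.
Proof.
  induction s as [|y s IH]; simpl; [contradiction|]; intros [<-|Hx].
  - pose proof (norm_sum_ge0 f s); lra.
  - specialize (IH Hx); pose proof (Cmod_ge_0 (f y)); lra.
Qed.

Lemma abs_summable_le {T : Type} (D E : T -> Prop) (f g : T -> C) (B : R) :
  (0 <= B)%R -> (forall x, D x -> E x) ->
  (forall x, D x -> (Cmod (f x) <= B * Cmod (g x))%R) ->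
  abs_summable E g -> abs_summable D f.
Proof.
  intros HB HDE Hfg [M HM]; exists (B * M)%R; intros s Hn Hs.
  eapply Rle_trans; [apply (norm_sum_le D f g B s Hs Hfg)|].
  apply Rmult_le_compat_l; [exact HB|].
  exact (HM s Hn (Forall_impl E HDE Hs)).
Qed.

Section Unconditional.

Context {T : Type} (T_eq_dec : forall x y : T, {x = y} + {x <> y}).

Lemma finite_subsets_proper (D : T -> Prop) : ProperFilter (finite_subsets D).
Proof.
  split; [|split].
  - intros P [s0 [H0 H]]; exists (nodup T_eq_dec s0); apply H.
    + apply NoDup_nodup.
    + apply Forall_forall; intros x Hx; apply nodup_In in Hx.
      now apply (proj1 (Forall_forall _ _) H0).
    + intros x Hx; now apply nodup_In.
  - exists nil; split; [constructor | trivial].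
  - intros P Q [s [Hs HP]] [t [Ht HQ]]; exists (s ++ t); split.
    + now apply Forall_app.
    + intros u Hn Hu Hi; split; [apply HP | apply HQ]; auto;
        intros x Hx; apply Hi, in_or_app; auto.
  - intros P Q HPQ [s [Hs HP]]; exists s; split; auto.
Qed.

(** A list containing [s] is, up to order, [s] followed by the entries outside
    [s]; this turns differences of partial sums into sums over complements. *)
Lemma Permutation_complement (s t : list T) :
  NoDup s -> NoDup t -> incl s t ->
  Permutation t (s ++ filter (fun x => if in_dec T_eq_dec x s then false else true) t).
Proof.
  intros Hs Ht Hi; apply NoDup_Permutation; [exact Ht | |].
  - apply NoDup_app; [exact Hs | now apply NoDup_filter |].
    intros x Hx Hf; apply filter_In in Hf as [_ Hf].
    destruct (in_dec T_eq_dec x s); [discriminate | contradiction].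
  - intros x; rewrite in_app_iff, filter_In.
    destruct (in_dec T_eq_dec x s) as [H|H]; split; intros H1.
    + now left.
    + now apply Hi.
    + now right.
    + destruct H1 as [H1|[H1 _]]; [contradiction | exact H1].
Qed.

(** Completeness of the complex plane: once a finite set carries all but [eps / 2]
    of the supremum of the sums of moduli, any two larger partial sums differ by
    less than [eps]. *)
Lemma abs_summable_has_sum (D : T -> Prop) (f : T -> C) :
  abs_summable D f -> exists v, has_sum D f v.
Proof.
  intros [M HM].
  apply (@filterlim_locally_cauchy _ C_CompleteNormedModule _ (finite_subsets_proper D)).
  set (E := fun r => exists s, NoDup s /\ List.Forall D s /\ r = norm_sum f s).
  destruct (completeness E) as [S [HS1 HS2]].
  { exists M; intros r [s [Hn [Hs ->]]]; now apply HM. }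
  { exists 0%R, nil; repeat split; constructor. }
  intros eps.
  assert (He : (0 < eps / 2)%R) by (pose proof (cond_pos eps); lra).
  assert (Hex : exists s, NoDup s /\ List.Forall D s /\ (S - eps / 2 < norm_sum f s)%R).
  { apply Classical_Prop.NNPP; intros Hno.
    assert (S <= S - eps / 2)%R; [|lra].
    apply HS2; intros r [s [Hn [Hs ->]]]; apply Rnot_lt_le; intros Hlt.
    apply Hno; now exists s. }
  destruct Hex as [s0 [Hn0 [H0 Hlt]]].
  assert (Htail : forall s, NoDup s -> List.Forall D s -> incl s0 s ->
                    (Cmod (sum_list f s - sum_list f s0) < eps / 2)%R).
  { intros s Hn Hs Hi.
    pose proof (Permutation_complement s0 s Hn0 Hn Hi) as Hp.
    set (t := filter _ s) in Hp.
    assert (HSs : (norm_sum f s <= S)%R) by (apply HS1; now exists s).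
    rewrite (norm_sum_Permutation f _ _ Hp), norm_sum_app in HSs.
    rewrite (sum_list_Permutation f _ _ Hp), sum_list_app.
    replace (_ + _ - _) with (sum_list f t) by ring.
    pose proof (Cmod_sum_list_le f t); lra. }
  exists (fun s => Cmod (sum_list f s - sum_list f s0) < eps / 2)%R; split.
  - exists s0; split; [exact H0 | exact Htail].
  - intros u v Hu Hv; apply C_NormedModule_mixin_compat1.
    change (Cmod (sum_list f v - sum_list f u) < eps)%R.
    replace (sum_list f v - sum_list f u)
      with ((sum_list f v - sum_list f s0) + - (sum_list f u - sum_list f s0)) by ring.
    eapply Rle_lt_trans; [apply Cmod_triangle|]; rewrite Cmod_opp; lra.
Qed.

Lemma has_sum_minus (D : T -> Prop) (f g : T -> C) (v w : C) :
  has_sum D f v -> has_sum D g w -> has_sum D (fun x => f x - g x) (v - w).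
Proof.
  intros Hf Hg; unfold has_sum.
  assert (Hfil : Filter (finite_subsets D)) by apply finite_subsets_proper.
  apply filterlim_ext with (fun s => sum_list f s - sum_list g s).
  { intros s; induction s as [|x s IH]; simpl; [ring|]. rewrite <- IH; ring. }
  apply (filterlim_comp_2 (G := locally v) (H := locally (- w))
           (sum_list f) (fun s => - sum_list g s) Cplus Hf).
  - eapply filterlim_comp; [exact Hg | apply (@filterlim_opp C_AbsRing C_NormedModule)].
  - apply (@filterlim_plus C_AbsRing C_NormedModule).
Qed.

Lemma has_sum_scal (D : T -> Prop) (f : T -> C) (a v : C) :
  has_sum D f v -> has_sum D (fun x => a * f x) (a * v).
Proof.
  intros Hf; unfold has_sum.
  assert (Hfil : Filter (finite_subsets D)) by apply finite_subsets_proper.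
  apply filterlim_ext with (fun s => a * sum_list f s).
  { intros s; induction s as [|x s IH]; simpl; [ring|]. rewrite <- IH; ring. }
  eapply filterlim_comp; [exact Hf | apply (@filterlim_scal_r C_AbsRing C_NormedModule)].
Qed.

Lemma has_sum_Cmod_le (D : T -> Prop) (f : T -> C) (v : C) (B : R) :
  has_sum D f v ->
  (forall s, NoDup s -> List.Forall D s -> (Cmod (sum_list f s) <= B)%R) ->
  (Cmod v <= B)%R.
Proof.
  intros Hf HB; apply Rnot_lt_le; intros Hlt.
  assert (He : (0 < Cmod v - B)%R) by lra.
  assert (Hloc : locally v (fun y => Cmod (y - v) < Cmod v - B)%R).
  { apply (@locally_le_locally_norm C_AbsRing C_NormedModule).
    exists (mkposreal _ He); intros y Hy; exact Hy. }
  apply Hf in Hloc.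
  destruct Hloc as [s0 [H0 Hs0]].
  set (s := nodup T_eq_dec s0).
  assert (Hn : NoDup s) by apply NoDup_nodup.
  assert (Hs : List.Forall D s).
  { apply Forall_forall; intros x Hx; apply nodup_In in Hx.
    now apply (proj1 (Forall_forall _ _) H0). }
  assert (Hi : incl s0 s) by (intros x Hx; now apply nodup_In).
  specialize (Hs0 s Hn Hs Hi); cbv beta in Hs0; specialize (HB s Hn Hs).
  pose proof (Cmod_triangle (sum_list f s) (- (sum_list f s - v))) as Ht.
  replace (sum_list f s + - (sum_list f s - v)) with v in Ht by ring.
  rewrite Cmod_opp in Ht; lra.
Qed.

(** Termwise differentiation without uniform convergence theorems: if the
    second-order Taylor remainders of the terms are dominated by
    [Cmod (tau - tau0) ^ 2] times a fixed summable family, the remainder of the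
    sum is quadratically small as well. *)
Lemma has_sum_is_derive (D : T -> Prop) (f : C -> T -> C) (g m : T -> C)
    (F : C -> C) (tau0 L : C) (r B : R) :
  (0 < r)%R -> (0 <= B)%R ->
  (forall tau, (Cmod (tau - tau0) < r)%R -> has_sum D (f tau) (F tau)) ->
  has_sum D g L ->
  abs_summable D m ->
  (forall tau x, (Cmod (tau - tau0) < r)%R -> D x ->
     (Cmod (f tau x - f tau0 x - (tau - tau0) * g x)
        <= B * Cmod (tau - tau0) ^ 2 * Cmod (m x))%R) ->
  @is_derive C_AbsRing C_NormedModule F tau0 L.
Proof.
  intros Hr HB HF Hg [M HM] Hrem.
  assert (HM0 : (0 <= M)%R)
    by (eapply Rle_trans; [|apply (HM nil)]; [simpl; lra | constructor | constructor]).
  assert (Hquad : forall tau, (Cmod (tau - tau0) < r)%R ->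
     (Cmod (F tau - F tau0 - (tau - tau0) * L) <= B * Cmod (tau - tau0) ^ 2 * M)%R).
  { intros tau Htau.
    apply (has_sum_Cmod_le D (fun x => f tau x - f tau0 x - (tau - tau0) * g x)).
    - apply has_sum_minus; [apply has_sum_minus|]; [apply HF.. | now apply has_sum_scal].
      + exact Htau.
      + replace (tau0 - tau0) with (RtoC 0) by ring; now rewrite Cmod_0.
    - intros s Hn Hs.
      eapply Rle_trans; [apply Cmod_sum_list_le|].
      eapply Rle_trans; [apply (norm_sum_le D _ m (B * Cmod (tau - tau0) ^ 2) s Hs); intros x Hx;
        now apply Hrem|].
      apply Rmult_le_compat_l; [|now apply HM].
      apply Rmult_le_pos; [exact HB | apply pow_le, Cmod_ge_0]. }
  split; [apply is_linear_scal_l|].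
  intros x Hx.
  apply (@is_filter_lim_locally_unique C_AbsRing (AbsRing_NormedModule C_AbsRing)) in Hx.
  subst x.
  intros eps.
  assert (Hk : (0 < B * M + 1)%R) by nra.
  assert (Hd : (0 < Rmin r (eps / (B * M + 1)))%R).
  { apply Rmin_glb_lt; [exact Hr | apply Rdiv_lt_0_compat; [apply cond_pos | exact Hk]]. }
  exists (mkposreal _ Hd); intros tau Htau.
  change (Cmod (tau - tau0) < Rmin r (eps / (B * M + 1)))%R in Htau.
  change (Cmod (F tau - F tau0 - (tau - tau0) * L) <= eps * Cmod (tau - tau0))%R.
  assert (H1 : (Cmod (tau - tau0) < r)%R)
    by (eapply Rlt_le_trans; [exact Htau | apply Rmin_l]).
  assert (H2 : (Cmod (tau - tau0) < eps / (B * M + 1))%R)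
    by (eapply Rlt_le_trans; [exact Htau | apply Rmin_r]).
  apply Rlt_div_r in H2; [|exact Hk].
  specialize (Hquad tau H1); pose proof (Cmod_ge_0 (tau - tau0)) as H3.
  eapply Rle_trans; [exact Hquad|].
  assert (0 <= B * M)%R by nra.
  nra.
Qed.

End Unconditional.

(** * Lattice sums *)

Definition sup_norm (p : Z * Z) : Z := Z.max (Z.abs (fst p)) (Z.abs (snd p)).

(** The pairs of sup norm [n], covered by the four sides of a square; the
    corners occur twice, which is harmless for an upper bound. *)
Definition square_sides (n : Z) : list (Z * Z) :=
  let range := map (fun j => Z.of_nat j - n)%Z (seq 0 (Z.to_nat (2 * n + 1))) in
  map (fun j => (n, j)) range ++ map (fun j => (- n, j)%Z) range ++
  map (fun j => (j, n)) range ++ map (fun j => (j, - n)%Z) range.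

Lemma length_square_sides (n : Z) :
  length (square_sides n) = (4 * Z.to_nat (2 * n + 1))%nat.
Proof.
  unfold square_sides; rewrite !length_app, !length_map, length_seq; lia.
Qed.

Lemma In_square_sides (p : Z * Z) : In p (square_sides (sup_norm p)).
Proof.
  destruct p as [c d]; set (n := sup_norm (c, d)).
  assert (Hn : (n = Z.max (Z.abs c) (Z.abs d))%Z) by reflexivity.
  clearbody n; unfold square_sides.
  assert (Hr : forall x, (Z.abs x <= n)%Z ->
    In x (map (fun j => Z.of_nat j - n)%Z (seq 0 (Z.to_nat (2 * n + 1))))).
  { intros x Hx; apply in_map_iff; exists (Z.to_nat (x + n)); split; [lia|].
    apply in_seq; lia. }
  rewrite !in_app_iff, !in_map_iff.
  assert (Hcase : (c = n \/ c = - n \/ d = n \/ d = - n)%Z) by lia.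
  assert (Hc : (Z.abs c <= n)%Z) by lia.
  assert (Hd : (Z.abs d <= n)%Z) by lia.
  destruct Hcase as [H|[H|[H|H]]].
  - left; exists d; split; [congruence | auto].
  - right; left; exists d; split; [congruence | auto].
  - right; right; left; exists c; split; [congruence | auto].
  - right; right; right; exists c; split; [congruence | auto].
Qed.

(** Complex-valued, so that it can serve as the majorant in a statement of
    absolute summability. *)
Definition inv_cube (p : Z * Z) : C := RtoC (/ IZR (sup_norm p) ^ 3).

Lemma Cmod_inv_cube (p : Z * Z) :
  (1 <= sup_norm p)%Z -> Cmod (inv_cube p) = (/ IZR (sup_norm p) ^ 3)%R.
Proof.
  intros Hp; apply IZR_le in Hp; unfold inv_cube; rewrite Cmod_R, Rabs_pos_eq; [reflexivity|].
  apply Rlt_le, Rinv_0_lt_compat, pow_lt; lra.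
Qed.

(** One shell contributes at most [4 * (2 * n + 1) / n ^ 3 <= 12 / n ^ 2]. *)
Lemma norm_sum_shell_le (n : Z) (s : list (Z * Z)) :
  (1 <= n)%Z -> NoDup s -> List.Forall (fun p => sup_norm p = n) s ->
  (norm_sum inv_cube s <= 12 / IZR n ^ 2)%R.
Proof.
  intros Hn Hd Hs.
  assert (Hn' : (1 <= IZR n)%R) by now apply IZR_le.
  assert (Hlen : (IZR (Z.of_nat (length s)) <= 12 * IZR n)%R).
  { rewrite <- mult_IZR; apply IZR_le.
    assert (Hl : (length s <= length (square_sides n))%nat).
    { apply NoDup_incl_length; [exact Hd|]; intros p Hp.
      rewrite <- (proj1 (Forall_forall _ _) Hs p Hp); apply In_square_sides. }
    rewrite length_square_sides in Hl; lia. }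
  assert (Heq : norm_sum inv_cube s = (IZR (Z.of_nat (length s)) * / IZR n ^ 3)%R).
  { clear Hd Hlen; induction Hs as [|p s Hp Hs IH]; simpl norm_sum; [simpl; lra|].
    rewrite IH, Cmod_inv_cube, Hp by lia.
    simpl length; rewrite Nat2Z.inj_succ, succ_IZR; ring. }
  rewrite Heq.
  replace (12 / IZR n ^ 2)%R with (12 * IZR n * / IZR n ^ 3)%R by (field; lra).
  apply Rmult_le_compat_r; [|exact Hlen].
  apply Rlt_le, Rinv_0_lt_compat, pow_lt; lra.
Qed.

Lemma filter_split_Permutation {T : Type} (p : T -> bool) (s : list T) :
  Permutation s (filter p s ++ filter (fun x => negb (p x)) s).
Proof.
  induction s as [|x s IH]; simpl; [constructor|].
  destruct (p x); simpl; [now constructor | now apply Permutation_cons_app].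
Qed.

(** The bound [24 * (1 - 1 / (n + 1))] telescopes: its increment
    [24 / (n * (n + 1))] absorbs the shell [12 / n ^ 2] because
    [n + 1 <= 2 * n]. *)
Lemma norm_sum_inv_cube_le (n : nat) (s : list (Z * Z)) :
  NoDup s -> List.Forall (fun p => (1 <= sup_norm p <= Z.of_nat n)%Z) s ->
  (norm_sum inv_cube s <= 24 * (1 - / (INR n + 1)))%R.
Proof.
  revert s; induction n as [|n IH]; intros s Hd Hs.
  - destruct Hs as [|p s Hp _]; [simpl; lra | lia].
  - set (top := fun p => Z.eqb (sup_norm p) (Z.of_nat (S n))).
    rewrite (norm_sum_Permutation _ _ _ (filter_split_Permutation top s)), norm_sum_app.
    assert (H1 : (norm_sum inv_cube (filter top s) <= 12 / IZR (Z.of_nat (S n)) ^ 2)%R).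
    { apply norm_sum_shell_le; [lia | now apply NoDup_filter |].
      apply Forall_forall; intros p Hp; apply filter_In in Hp as [_ Hp].
      now apply Z.eqb_eq. }
    assert (H2 : (norm_sum inv_cube (filter (fun p => negb (top p)) s)
                    <= 24 * (1 - / (INR n + 1)))%R).
    { apply IH; [now apply NoDup_filter|].
      apply Forall_forall; intros p Hp; apply filter_In in Hp as [Hp Ht].
      apply (proj1 (Forall_forall _ _) Hs) in Hp; unfold top in Ht.
      apply Bool.negb_true_iff, Z.eqb_neq in Ht; lia. }
    rewrite <- INR_IZR_INZ in H1; rewrite S_INR in *.
    pose proof (pos_INR n) as Hn; set (x := INR n) in *.
    assert (H3 : (12 / (x + 1) ^ 2 <= 24 * (/ (x + 1) - / (x + 1 + 1)))%R).
    { replace (24 * (/ (x + 1) - / (x + 1 + 1)))%R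
        with (12 / (x + 1) ^ 2 * (2 * (x + 1) / (x + 1 + 1)))%R by (field; lra).
      rewrite <- (Rmult_1_r (12 / (x + 1) ^ 2)) at 1.
      apply Rmult_le_compat_l.
      - apply Rlt_le, Rdiv_lt_0_compat; [lra | apply pow_lt; lra].
      - apply Rle_div_r; lra. }
    lra.
Qed.

Definition nonzero_pair (p : Z * Z) : Prop := ~ (fst p = 0%Z /\ snd p = 0%Z).

Lemma sup_norm_ge1 (p : Z * Z) : nonzero_pair p -> (1 <= sup_norm p)%Z.
Proof. unfold nonzero_pair, sup_norm; lia. Qed.

Lemma abs_summable_inv_cube : abs_summable nonzero_pair inv_cube.
Proof.
  exists 24%R; intros s Hd Hs.
  assert (Hbound : exists n : nat, List.Forall (fun p => (1 <= sup_norm p <= Z.of_nat n)%Z) s).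
  { clear Hd; induction Hs as [|p s Hp Hs [n Hn]]; [now exists O|].
    apply sup_norm_ge1 in Hp.
    exists (Nat.max n (Z.to_nat (sup_norm p))); constructor; [lia|].
    eapply Forall_impl; [|exact Hn]; cbv beta; intros; lia. }
  destruct Hbound as [n Hn].
  eapply Rle_trans; [apply (norm_sum_inv_cube_le n s Hd Hn)|].
  assert (0 < / (INR n + 1))%R by (apply Rinv_0_lt_compat; pose proof (pos_INR n); lra).
  lra.
Qed.

(** * Eisenstein series with bounded coefficients *)

Definition lattice_point (tau : C) (p : Z * Z) : C := ZtoC (fst p) * tau + ZtoC (snd p).

Lemma Im_lattice_point (tau : C) (p : Z * Z) :
  Im (lattice_point tau p) = (IZR (fst p) * Im tau)%R.
Proof. destruct tau as [x y]; unfold lattice_point, ZtoC; simpl; ring. Qed.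

Lemma im_le_Cmod (z : C) : (Rabs (Im z) <= Cmod z)%R.
Proof. eapply Rle_trans; [apply Rmax_r | apply Rmax_Cmod]. Qed.

Lemma abs_fst_le (tau : C) (p : Z * Z) :
  upper_half_plane tau ->
  (Rabs (IZR (fst p)) * Im tau <= Cmod (lattice_point tau p))%R.
Proof.
  intros Htau; rewrite <- (Rabs_pos_eq (Im tau)) at 1 by now apply Rlt_le.
  rewrite <- Rabs_mult, <- Im_lattice_point; apply im_le_Cmod.
Qed.

(** [c] is controlled by the imaginary part of [c * tau + d], and then [d] by
    the triangle inequality. *)
Lemma sup_norm_le_lattice_point (tau : C) :
  upper_half_plane tau -> exists K, (0 < K)%R /\
  forall p, (IZR (sup_norm p) <= K * Cmod (lattice_point tau p))%R.
Proof.
  intros Htau; pose proof Htau as Hy; red in Hy.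
  pose proof (Cmod_ge_0 tau) as Ht.
  assert (Hi : (0 < / Im tau)%R) by now apply Rinv_0_lt_compat.
  exists (/ Im tau + 1 + Cmod tau * / Im tau)%R; split; [nra|].
  intros p; pose proof (abs_fst_le tau p Htau) as Hc.
  set (u := Cmod (lattice_point tau p)) in *.
  assert (Hu : (0 <= u)%R) by apply Cmod_ge_0.
  assert (Hc' : (Rabs (IZR (fst p)) <= / Im tau * u)%R).
  { apply (Rmult_le_reg_r (Im tau)); [exact Hy|].
    replace (/ Im tau * u * Im tau)%R with u by (field; lra); exact Hc. }
  assert (Hd : (Rabs (IZR (snd p)) <= u + Rabs (IZR (fst p)) * Cmod tau)%R).
  { replace (Rabs (IZR (snd p)))
      with (Cmod (lattice_point tau p + - (ZtoC (fst p) * tau))).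
    - eapply Rle_trans; [apply Cmod_triangle|].
      rewrite Cmod_opp, Cmod_mult; unfold ZtoC; rewrite Cmod_R; apply Rle_refl.
    - rewrite <- Cmod_R; f_equal; unfold lattice_point, ZtoC; ring. }
  assert (Hp : (0 <= Cmod tau * / Im tau * u)%R)
    by (apply Rmult_le_pos; [apply Rmult_le_pos; lra | exact Hu]).
  assert (Hp' : (0 <= / Im tau * u)%R) by (apply Rmult_le_pos; lra).
  assert (Hcd : (Rabs (IZR (fst p)) * Cmod tau <= / Im tau * u * Cmod tau)%R)
    by (apply Rmult_le_compat_r; assumption).
  unfold sup_norm; destruct (Z.max_spec (Z.abs (fst p)) (Z.abs (snd p))) as [[_ ->]|[_ ->]];
    rewrite abs_IZR; lra.
Qed.

Lemma lattice_point_neq0 (tau : C) (p : Z * Z) :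
  upper_half_plane tau -> nonzero_pair p -> lattice_point tau p <> RtoC 0.
Proof.
  intros Htau Hp H0; destruct (sup_norm_le_lattice_point tau Htau) as [K [_ HK]].
  specialize (HK p); rewrite H0, Cmod_0, Rmult_0_r in HK.
  apply le_IZR in HK; pose proof (sup_norm_ge1 p Hp); lia.
Qed.

Lemma abs_summable_lattice (tau : C) (k : nat) :
  (3 <= k)%nat -> upper_half_plane tau ->
  abs_summable nonzero_pair (fun p => / lattice_point tau p ^ k).
Proof.
  intros Hk Htau; destruct (sup_norm_le_lattice_point tau Htau) as [K [HK Hle]].
  apply abs_summable_le with (E := nonzero_pair) (g := inv_cube) (B := (K ^ k)%R);
    [apply pow_le; lra | trivial | | apply abs_summable_inv_cube].
  intros p Hp; pose proof (sup_norm_ge1 p Hp) as H1; rewrite Cmod_inv_cube by exact H1.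
  apply IZR_le in H1.
  pose proof (lattice_point_neq0 tau p Htau Hp) as Hnz.
  rewrite Cmod_inv by now apply Cpow_nz.
  rewrite Cmod_pow; apply Cmod_gt_0 in Hnz; specialize (Hle p).
  set (u := Cmod _) in *; set (n := IZR (sup_norm p)) in *.
  assert (Hpow : (n ^ 3 <= K ^ k * u ^ k)%R).
  { apply Rle_trans with (n ^ k)%R; [now apply Rle_pow|].
    rewrite <- Rpow_mult_distr; apply pow_incr; lra. }
  assert (Hu : (0 < u ^ k)%R) by now apply pow_lt.
  assert (Hn : (0 < n ^ 3)%R) by (apply pow_lt; lra).
  revert Hpow Hu Hn; generalize (u ^ k)%R (n ^ 3)%R (K ^ k)%R; intros U N Q Hpow HU HN.
  apply (Rmult_le_reg_r (U * N)); [nra|].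
  replace (/ U * (U * N))%R with N by (field; lra).
  replace (Q * / N * (U * N))%R with (Q * U)%R by (field; lra).
  exact Hpow.
Qed.

(** Induction on [k] through
    [w ^ (k+1) - 1 + (k+1) z = w (w ^ k - 1 + k z) + (k+1) w z ^ 2] for
    [w = 1 / (1 + z)], together with [Cmod w <= 2]. *)
Lemma inv_pow_taylor (k : nat) : exists B, (0 <= B)%R /\
  forall z : C, (Cmod z <= / 2)%R ->
    (Cmod ((/ (1 + z)) ^ k - 1 + RtoC (INR k) * z) <= B * Cmod z ^ 2)%R.
Proof.
  induction k as [|k [B [HB IH]]].
  - exists 0%R; split; [lra|]; intros z _.
    replace (_ - _ + _) with (RtoC 0) by (simpl; ring); rewrite Cmod_0; lra.
  - exists (2 * B + 2 * (INR k + 1))%R; pose proof (pos_INR k) as Hk.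
    split; [lra|]; intros z Hz; specialize (IH z Hz).
    assert (H1z : (/ 2 <= Cmod (1 + z))%R).
    { pose proof (Cmod_triangle (1 + z) (- z)) as Ht.
      replace (1 + z + - z) with (RtoC 1) in Ht by ring.
      rewrite Cmod_opp, Cmod_1 in Ht; lra. }
    assert (Hnz : 1 + z <> RtoC 0) by (apply Cmod_gt_0; lra).
    assert (Hw : (Cmod (/ (1 + z)) <= 2)%R).
    { rewrite Cmod_inv by exact Hnz; rewrite <- (Rinv_inv 2).
      apply Rinv_le_contravar; lra. }
    assert (Hinv : / (1 + z) * (1 + z) = RtoC 1) by now apply Cinv_l.
    rewrite S_INR, RtoC_plus, Cpow_S.
    set (w := / (1 + z)) in *; set (a := RtoC (INR k)) in *.
    replace (w * w ^ k - 1 + (a + 1) * z)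
      with (w * (w ^ k - 1 + a * z) + w * ((a + 1) * z ^ 2)
            + (w * (1 + z) - 1) * (1 - (a + 1) * z)) by (simpl; ring).
    rewrite Hinv.
    replace ((1 - 1) * (1 - (a + 1) * z)) with (RtoC 0) by ring; rewrite Cplus_0_r.
    eapply Rle_trans; [apply Cmod_triangle|]; rewrite !Cmod_mult, Cmod_pow.
    assert (Ha : (Cmod (a + 1) = INR k + 1)%R).
    { unfold a; rewrite <- RtoC_plus, Cmod_R; apply Rabs_pos_eq; lra. }
    rewrite Ha.
    pose proof (Cmod_ge_0 w); pose proof (pow2_ge_0 (Cmod z)).
    pose proof (Cmod_ge_0 (w ^ k - 1 + a * z)).
    assert (Cmod w * Cmod (w ^ k - 1 + a * z) <= 2 * (B * Cmod z ^ 2))%R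
      by (apply Rmult_le_compat; assumption).
    assert (Cmod w * ((INR k + 1) * Cmod z ^ 2) <= 2 * ((INR k + 1) * Cmod z ^ 2))%R
      by (apply Rmult_le_compat_r; [nra | assumption]).
    lra.
Qed.

(** Moving [tau0] to [tau] multiplies [c * tau0 + d] by [1 + z] with
    [z = c * (tau - tau0) / (c * tau0 + d)], and [Cmod z] is at most
    [Cmod (tau - tau0) / Im tau0] for every [(c, d)]: this uniformity in the
    lattice point is what makes the remainders summable. *)
Lemma lattice_term_taylor (k : nat) (tau0 : C) :
  upper_half_plane tau0 -> exists B, (0 <= B)%R /\
  forall tau p, (Cmod (tau - tau0) < Im tau0 / 2)%R -> nonzero_pair p ->
    (Cmod (/ lattice_point tau p ^ k - / lattice_point tau0 p ^ k
           - (tau - tau0) * (- (RtoC (INR k) * (ZtoC (fst p) / lattice_point tau0 p))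
                             * / lattice_point tau0 p ^ k))
       <= B * Cmod (tau - tau0) ^ 2 * Cmod (/ lattice_point tau0 p ^ k))%R.
Proof.
  intros Htau0; destruct (inv_pow_taylor k) as [B [HB Htaylor]].
  pose proof Htau0 as Hy; red in Hy.
  assert (Hi : (0 < / Im tau0)%R) by now apply Rinv_0_lt_compat.
  exists (B * (/ Im tau0) ^ 2)%R; split.
  { apply Rmult_le_pos; [exact HB | apply pow_le; lra]. }
  intros tau p Htau Hp.
  pose proof (lattice_point_neq0 tau0 p Htau0 Hp) as Hu0.
  pose proof (abs_fst_le tau0 p Htau0) as Hc.
  assert (Hu : lattice_point tau p
               = lattice_point tau0 p * (1 + ZtoC (fst p) * (tau - tau0) / lattice_point tau0 p)).
  { transitivity (lattice_point tau0 p + ZtoC (fst p) * (tau - tau0)).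
    - unfold lattice_point; ring.
    - field; exact Hu0. }
  set (u0 := lattice_point tau0 p) in *.
  set (c := ZtoC (fst p)) in *; set (h := tau - tau0) in *.
  assert (Hz : (Cmod (c * h / u0) <= / Im tau0 * Cmod h)%R).
  { rewrite Cmod_div, Cmod_mult by exact Hu0.
    unfold c, ZtoC; rewrite Cmod_R.
    apply Cmod_gt_0 in Hu0; pose proof (Cmod_ge_0 h) as Hh.
    apply Rle_div_l; [exact Hu0|].
    replace (Rabs (IZR (fst p)) * Cmod h)%R
      with (/ Im tau0 * Cmod h * (Rabs (IZR (fst p)) * Im tau0))%R by (field; lra).
    apply Rmult_le_compat_l; [apply Rmult_le_pos; lra | exact Hc]. }
  set (z := c * h / u0) in *.
  assert (Hz2 : (Cmod z <= / 2)%R).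
  { eapply Rle_trans; [exact Hz|].
    apply (Rmult_le_reg_l (Im tau0)); [exact Hy|].
    rewrite <- Rmult_assoc, Rinv_r by lra; lra. }
  assert (H1z : 1 + z <> RtoC 0).
  { intros H0; replace z with (- RtoC 1) in Hz2.
    - rewrite Cmod_opp, Cmod_1 in Hz2; lra.
    - replace z with (1 + z + - RtoC 1) by ring; rewrite H0; ring. }
  rewrite Hu, Cpow_mult_l.
  assert (Hk0 : u0 ^ k <> RtoC 0) by now apply Cpow_nz.
  assert (Hk1 : (1 + z) ^ k <> RtoC 0) by now apply Cpow_nz.
  replace (/ (u0 ^ k * (1 + z) ^ k) - / u0 ^ k
           - h * (- (RtoC (INR k) * (c / u0)) * / u0 ^ k))
    with (((/ (1 + z)) ^ k - 1 + RtoC (INR k) * z) * / u0 ^ k).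
  2:{ rewrite Cpow_inv by exact H1z; unfold z at 2; generalize dependent (u0 ^ k).
      intros v Hv; generalize dependent ((1 + z) ^ k); intros w Hw.
      field; auto. }
  rewrite Cmod_mult; apply Rmult_le_compat_r; [apply Cmod_ge_0|].
  eapply Rle_trans; [now apply Htaylor|].
  rewrite Rmult_assoc; apply Rmult_le_compat_l; [exact HB|].
  rewrite <- Rpow_mult_distr; apply pow_incr; split; [apply Cmod_ge_0 | exact Hz].
Qed.

Lemma upper_half_plane_near (tau0 tau : C) :
  upper_half_plane tau0 -> (Cmod (tau - tau0) < Im tau0 / 2)%R -> upper_half_plane tau.
Proof.
  unfold upper_half_plane; intros Hy Htau.
  pose proof (im_le_Cmod (tau - tau0)) as Him.
  replace (Im (tau - tau0)) with (Im tau - Im tau0)%R in Him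
    by (destruct tau, tau0; simpl; ring).
  apply Rabs_le_between in Him; lra.
Qed.

(** The function [a] absorbs every factor independent of [tau], so that a term
    and its derivative in [tau] are both bounded by a multiple of
    [/ Cmod (c * tau + d) ^ k]. *)
Lemma eisenstein_bounded_coefficients (D : Z * Z -> Prop) (k : nat)
    (f : C -> Z * Z -> C) (a : Z * Z -> C) (A : R) :
  (3 <= k)%nat ->
  (forall p, D p -> nonzero_pair p) ->
  (forall p, D p -> (Cmod (a p) <= A)%R) ->
  (forall tau p, f tau p = / lattice_point tau p ^ k * a p) ->
  converges_absolutely_to_holomorphic D f.
Proof.
  intros Hk HD Ha Hf.
  (* [Rmax A 0] because [D] may be empty, in which case [A] may be negative *)
  assert (Ha' : forall p, D p -> (Cmod (a p) <= Rmax A 0)%R)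
    by (intros p Hp; eapply Rle_trans; [now apply Ha | apply Rmax_l]).
  assert (HA : (0 <= Rmax A 0)%R) by apply Rmax_r.
  clear Ha; revert Ha' HA; generalize (Rmax A 0); clear A; intros A Ha HA.
  assert (Habs : forall tau, upper_half_plane tau -> abs_summable D (f tau)).
  { intros tau Htau.
    apply abs_summable_le with (4 := abs_summable_lattice tau k Hk Htau) (B := A);
      [exact HA | exact HD |].
    intros p Hp; rewrite Hf, Cmod_mult, Rmult_comm.
    apply Rmult_le_compat_r; [apply Cmod_ge_0 | now apply Ha]. }
  assert (pair_eq_dec : forall p q : Z * Z, {p = q} + {p <> q})
    by (decide equality; apply Z.eq_dec).
  split; [exact Habs|].
  destruct (functional_choice (fun tau v => upper_half_plane tau -> has_sum D (f tau) v))
    as [F HF].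
  { intros tau; destruct (Rlt_dec 0 (Im tau)) as [Htau|Htau].
    - destruct (abs_summable_has_sum pair_eq_dec D _ (Habs tau Htau)) as [v Hv]; now exists v.
    - exists (RtoC 0); intros H; contradiction. }
  exists F; split; [exact HF|].
  intros tau0 Htau0; pose proof Htau0 as Hy; red in Hy.
  destruct (lattice_term_taylor k tau0 Htau0) as [B [HB Htaylor]].
  pose proof (abs_summable_lattice tau0 k Hk Htau0) as Hlat.
  set (g := fun p => (- (RtoC (INR k) * (ZtoC (fst p) / lattice_point tau0 p))
                      * / lattice_point tau0 p ^ k) * a p).
  (* [c / (c * tau0 + d)] is bounded, so the derivatives of the terms decay no
     more slowly than the terms do *)
  assert (Hg : abs_summable D g).
  { assert (Hi : (0 < / Im tau0)%R) by now apply Rinv_0_lt_compat.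
    pose proof (pos_INR k) as Hk0.
    apply abs_summable_le with (4 := Hlat) (B := (INR k * / Im tau0 * A)%R);
      [repeat apply Rmult_le_pos; lra | exact HD |].
    intros p Hp; pose proof (lattice_point_neq0 tau0 p Htau0 (HD p Hp)) as Hu0.
    pose proof (abs_fst_le tau0 p Htau0) as Hc.
    unfold g; rewrite !Cmod_mult, Cmod_opp, Cmod_mult, Cmod_div by exact Hu0.
    unfold ZtoC; rewrite !Cmod_R, (Rabs_pos_eq (INR k)) by exact Hk0.
    assert (Hq : (Rabs (IZR (fst p)) / Cmod (lattice_point tau0 p) <= / Im tau0)%R).
    { apply Rle_div_l; [now apply Cmod_gt_0|].
      apply (Rmult_le_reg_l (Im tau0)); [exact Hy|].
      rewrite <- Rmult_assoc, Rinv_r by lra; lra. }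
    pose proof (Cmod_ge_0 (/ lattice_point tau0 p ^ k)) as Hm.
    rewrite Rmult_assoc, (Rmult_comm (Cmod (/ _))), <- Rmult_assoc.
    apply Rmult_le_compat_r; [exact Hm|].
    apply Rmult_le_compat; [|apply Cmod_ge_0 | | now apply Ha].
    - apply Rmult_le_pos; [exact Hk0|].
      apply Rdiv_le_0_compat; [apply Rabs_pos | now apply Cmod_gt_0].
    - now apply Rmult_le_compat_l. }
  destruct (abs_summable_has_sum pair_eq_dec D g Hg) as [L HL]; exists L.
  apply (has_sum_is_derive pair_eq_dec D f g (fun p => RtoC A * / lattice_point tau0 p ^ k)
           F tau0 L (Im tau0 / 2) B); [lra | exact HB | | exact HL | |].
  - intros tau Htau; apply HF; now apply upper_half_plane_near with tau0.
  - apply abs_summable_le with (4 := Hlat) (B := A); [exact HA | exact HD |].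
    intros p _; rewrite Cmod_mult, Cmod_R, Rabs_pos_eq by exact HA; apply Rle_refl.
  - intros tau p Htau Hp; specialize (Htaylor tau p Htau (HD p Hp)).
    rewrite !Hf; unfold g.
    match type of Htaylor with (Cmod ?e <= _)%R =>
      replace (_ - _ - _) with (a p * e) by ring end.
    rewrite !Cmod_mult, Cmod_R, Rabs_pos_eq by exact HA.
    rewrite (Rmult_comm A), <- Rmult_assoc, (Rmult_comm _ A).
    apply Rmult_le_compat; [apply Cmod_ge_0 | apply Cmod_ge_0 | now apply Ha | exact Htaylor].
Qed.

(** * Boundedness of the coefficients *)

Lemma Cmod_Cexp (z : C) : Cmod (Cexp z) = exp (Re z).
Proof.
  unfold Cexp; rewrite Cmod_mult, Cmod_R, Rabs_pos_eq by apply Rlt_le, exp_pos.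
  replace (Cmod (cos (Im z), sin (Im z))) with 1%R; [ring|].
  unfold Cmod; simpl fst; simpl snd.
  replace (cos (Im z) ^ 2 + sin (Im z) ^ 2)%R with 1%R; [now rewrite sqrt_1|].
  rewrite <- (sin2_cos2 (Im z)); unfold Rsqr; ring.
Qed.

Lemma Cmod_Cexp_phase (x : R) : Cmod (Cexp (2 * PI * Ci * x)) = 1%R.
Proof.
  rewrite Cmod_Cexp; replace (Re _) with 0%R by (simpl; ring); apply exp_0.
Qed.

(** By periodicity every value of [chi] at an integer prime to [l] is taken on
    [0, ..., l - 1]; the sum of the moduli there is a convenient substitute for
    the maximum. *)
Lemma unit_character_bounded (l : Z) (chi : Z -> C) :
  (1 <= l)%Z -> unit_character l chi ->
  exists A, forall d, Z.gcd d l = 1%Z -> (Cmod (chi d) <= A)%R.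
Proof.
  intros Hl Hchi.
  exists (norm_sum chi (map Z.of_nat (seq 0 (Z.to_nat l)))); intros d Hd.
  pose proof (Z.mod_pos_bound d l ltac:(lia)) as Hm.
  rewrite (unit_character_mod l chi Hchi d (d mod l)%Z Hd).
  - apply norm_sum_In, in_map_iff; exists (Z.to_nat (d mod l)); split; [lia|].
    apply in_seq; lia.
  - exists (d / l)%Z; rewrite Z.mod_eq by lia; ring.
Qed.

Theorem proposition2p4 (l : Z) (hl : (1 <= l)%Z)
    (h : C -> C) (hh : weight2_cusp_form l h)
    (i : Z) (chi : Z -> C) (hchi : unit_character l chi)
    (k : nat) (hk : (3 <= k)%nat) :
  converges_absolutely_to_holomorphic (E_index l) (E_term l k i h) /\
  converges_absolutely_to_holomorphic (Ehat_index l) (Ehat_term k chi h).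
Proof.
  split.
  - apply eisenstein_bounded_coefficients with (k := k) (A := 1%R)
      (a := fun p => Cexp (- (2 * PI * Ci * (ZtoC (snd p * i) / ZtoC l)))
                     * Cexp (2 * PI * Ci * Re (H_cusp h (fst p) (snd p)))).
    + exact hk.
    + intros [c d] (_ & _ & Hcd); exact Hcd.
    + intros [c d] _; cbn [fst snd].
      assert (Hl : IZR l <> 0%R) by (apply not_0_IZR; lia).
      replace (- (2 * PI * Ci * (ZtoC (d * i) / ZtoC l)))
        with (2 * PI * Ci * RtoC (- (IZR (d * i) / IZR l))).
      * rewrite Cmod_mult, !Cmod_Cexp_phase; lra.
      * unfold ZtoC; rewrite RtoC_opp, RtoC_div by exact Hl; ring.
    + intros tau [c d]; unfold E_term, lattice_point; cbn [fst snd]; ring.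
  - destruct (unit_character_bounded l chi hl hchi) as [A HA].
    apply eisenstein_bounded_coefficients with (k := k) (A := A)
      (a := fun p => chi (snd p) * Cexp (2 * PI * Ci * Re (H_cusp h (fst p) (snd p)))).
    + exact hk.
    + intros [c d] (_ & Hcd) [Hc Hd]; cbn [fst snd] in Hc, Hd; subst.
      discriminate Hcd.
    + intros [c d] ([q ->] & Hcd); cbn [fst snd].
      rewrite Cmod_mult, Cmod_Cexp_phase, Rmult_1_r; apply HA.
      (* a common divisor of [d] and [l] divides [c = q * l] *)
      apply Z.divide_1_r_nonneg; [apply Z.gcd_nonneg|].
      rewrite <- Hcd; apply Z.gcd_greatest.
      * apply Z.divide_mul_r, Z.gcd_divide_r.
      * apply Z.gcd_divide_l.
    + intros tau [c d]; unfold Ehat_term, lattice_point; cbn [fst snd]; ring.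
Qed.
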